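(* Let $S$ be a set with a ternary operation $[\ ]$. Then $(S,[\ ])$ is a heap if and only if every element of $S$ is bi-unitary and, for all $x,y,z,q\in S$, (1) $[xyz]=q$ implies $[zqx]=y$, and (2) $[xyz]=[[xyq]qz]=[x[qzy]q]$.
   Context: A set $S$ with a ternary operation $[\ ]$ is a semiheap if $[[xyz]uv]=[x[uzy]v]=[xy[zuv]]$ for all $x,y,z,u,v\in S$. An element $l$ is bi-unitary if $[llx]=x=[xll]$ for all $x\in S$. A heap is a semiheap in which every element is bi-unitary. *)

(* Defs.v *)
Set Implicit Arguments.

(* The ternary product [xyz] is written  op x y z.  The carrier may be empty. *)

Definition semiheap (S : Type) (op : S -> S -> S -> S) : Prop :=
  forall x y z u v : S,
    op (op x y z) u v = op x (op u z y) v /\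
    op x (op u z y) v = op x y (op z u v).

Definition bi_unitary (S : Type) (op : S -> S -> S -> S) (l : S) : Prop :=
  forall x : S, op l l x = x /\ x = op x l l.

Definition heap (S : Type) (op : S -> S -> S -> S) : Prop :=
  semiheap op /\ forall l : S, bi_unitary op l.

(* Main.v *)
(* In a heap, the semiheap law moves brackets until a repeated argument cancels.
   Conversely, fix a base point e and put x * z := [x e z], y' := [e y e].
   Then [x y z] = (x * y') * z, and (1) and (2) force (x * a) * a' = x and
   (x * z)' = z' * x'; under these, [x y z] = [x [q z y] q] at q = e becomes
   associativity of *, so [] is the heap of a group. *)
Require Import Defs.

(** The involution reverses the inner product, (u * z' * y)' = y' * z * u', so all three bracketings
    flatten to x * y' * z * u' * v. *)
Lemma semiheap_of_involution (S : Type) (op : S -> S -> S -> S)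
    (mul : S -> S -> S) (inv : S -> S) :
  (forall x y z, op x y z = mul (mul x (inv y)) z) ->
  (forall x y z, mul (mul x y) z = mul x (mul y z)) ->
  (forall x y, inv (mul x y) = mul (inv y) (inv x)) ->
  (forall x, inv (inv x) = x) ->
  semiheap op.
Proof.
  intros opE mulA invM invK x y z u v.
  rewrite !opE, !invM, !invK, !mulA; auto.
Qed.

Lemma semiheap_of_identities (S : Type) (op : S -> S -> S -> S) (e : S) :
  (forall l, bi_unitary op l) ->
  (forall x y z q, op x y z = q -> op z q x = y) ->
  (forall x y z q, op x y z = op (op x y q) q z) ->
  (forall x y z q, op x y z = op x (op q z y) q) ->
  semiheap op.
Proof.
  intros unit rot shift twist.
  assert (unitl : forall l x, op l l x = x) by (intros; apply unit).
  assert (unitr : forall l x, op x l l = x)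
    by (intros; symmetry; apply unit).
  set (mul x z := op x e z); set (inv y := op e y e).
  assert (invK : forall x, inv (inv x) = x)
    by (intro x; exact (rot e x e _ eq_refl)).
  assert (mulV : forall x z, mul x (inv z) = op x z e).
  { intros x z; unfold mul; rewrite (twist x e (inv z) e).
    fold (inv (inv z)); now rewrite invK. }
  assert (opE : forall x y z, op x y z = mul (mul x (inv y)) z)
    by (intros; rewrite mulV; apply shift).
  assert (mule : forall x, mul x e = x) by (intro; apply unitr).
  assert (inve : inv e = e) by apply unitl.
  (* This is [shift] read at [x e e] = [[x e a] a e], whose left side is x. *)
  assert (mulK : forall x a, mul (mul x a) (inv a) = x).
  { intros x a; rewrite mulV; unfold mul.
    rewrite <- (shift x e e a); apply unitr. }
  assert (emul : forall x, mul e x = x) by (intro; apply unitl).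
  assert (cancel : forall w x, mul w x = e -> w = inv x).
  { intros w x H; rewrite <- (mulK w x), H; apply emul. }
  assert (invM : forall x z, inv (mul x z) = mul (inv z) (inv x)).
  { intros x z; set (q := mul x z).
    (* Rotating [x e z] = q gives [z q x] = e, that is (z * q') * x = e. *)
    assert (H1 : mul z (inv q) = inv x).
    { apply cancel; rewrite <- opE; apply rot; reflexivity. }
    (* Rotating [H1], read as [z e q'] = x', gives (q' * x) * z = e; multiplying z' = q' * x by x'
       on the right then isolates q'. *)
    assert (H2 : mul (inv q) x = inv z).
    { apply cancel; pose proof (rot _ _ _ _ H1) as H3.
      rewrite opE, invK in H3; exact H3. }
    now rewrite <- H2, mulK. }
  apply (@semiheap_of_involution S op mul inv); auto.
  intros x a z.
  (* The middle argument is a' because the product primes it again; the inner [e z a'] has inverse a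
     * z. *)
  pose proof (twist x (inv a) z e) as H.
  rewrite !opE, !invM, !invK, inve, !mule in H; exact H.
Qed.

Theorem theorem72 (S : Type) (op : S -> S -> S -> S) :
  heap op <->
  ((forall l : S, bi_unitary op l) /\
   (forall x y z q : S,
      (op x y z = q -> op z q x = y) /\
      (op x y z = op (op x y q) q z /\
       op (op x y q) q z = op x (op q z y) q))).
Proof.
  split.
  - intros [para unit]; split; [exact unit |].
    assert (assoc : forall x y z u v,
        op (op x y z) u v = op x y (op z u v)).
    { intros x y z u v; destruct (para x y z u v); congruence. }
    assert (mid : forall x y z u v,
        op x (op u z y) v = op x y (op z u v)) by (intros; apply para).
    assert (unitl : forall l x, op l l x = x) by (intros; apply unit).
    assert (unitr : forall l x, op x l l = x)
      by (intros; symmetry; apply unit).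
    (* Moving brackets leaves [z z [y x x]] for (1), and [x y [q q z]] and [x y [z q q]] for (2). *)
    intros x y z q; split; [intros <- |];
      now rewrite ?assoc, ?mid, ?unitl, ?unitr.
  - intros [unit H]; split; [| exact unit].
    (* The carrier may be empty, so the base point is the first element to which the semiheap law is
       applied. *)
    intros x.
    refine (@semiheap_of_identities S op x unit _ _ _ x); intros a b c d.
    + apply H.
    + apply H.
    + destruct (H a b c d) as [_ [-> ->]]; reflexivity.
Qed.
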